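(* Let $n\geq 2$. The dimension of the diameter polytope $P^{n}_{\overline{\mathrm{LOD}}}$ of the linear ordering problem satisfies $\dim P^{n}_{\overline{\mathrm{LOD}}}=2n(n-1)$.
   Context: $[n]=\{1,\ldots,n\}$; vectors in $\mathbb{R}^{n(n-1)}$ are indexed by ordered pairs $(i,j)$, $i\neq j$, $i,j\in[n]$; $\oplus$ denotes concatenation. $P^{n}_{\overline{\mathrm{LOD}}}\subseteq\mathbb{R}^{3n(n-1)}$ is the convex hull of all $x\oplus y\oplus z\in\{0,1\}^{3n(n-1)}$ such that: $x_{ij}+x_{ji}=1$ and $y_{ij}+y_{ji}=1$ for all $i<j$; $x_{ij}+x_{jk}+x_{ki}\leq 2$ and $y_{ij}+y_{jk}+y_{ki}\leq 2$ for all $i,j,k\in[n]$ with $i<j$, $i<k$, $j\neq k$; and $x_{ij}+y_{ij}-z_{ij}\leq 1$ for all $i\neq j$. The dimension of a polytope is the dimension of its affine hull. *)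

(* Defs.v *)
From mathcomp Require Import all_boot all_order all_algebra.
From mathcomp Require Import boolp classical_sets reals convex.

Set Implicit Arguments.
Unset Strict Implicit.
Unset Printing Implicit Defensive.

Import Order.TTheory GRing.Theory Num.Theory.

Local Open Scope classical_set_scope.
Local Open Scope ring_scope.

Section AffineGeometry.
Variables (R : realType) (V : vectType R).

Definition convex_hull (A : set V) : set V := smallest (@convex_set R V) A.

Definition affine_set (A : set V) : Prop :=
  forall (t : R) (x y : V), A x -> A y -> A (t *: x + (1 - t) *: y).

Definition affine_hull (A : set V) : set V := smallest affine_set A.

(* "dim A = d": the affine hull of A is a translate of a linear subspace of
   dimension d.  Stated as a relation, so that the empty set has no dimension;
   the lemma affine_dim_unique shows that it is functional. *)
Definition affine_dim (A : set V) (d : nat) : Prop :=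
  exists (p : V) (U : {vspace V}),
    affine_hull A = [set p + u | u in [set` U]] /\ \dim U = d.

Lemma affine_dim_unique (A : set V) (d e : nat) :
  affine_dim A d -> affine_dim A e -> d = e.
Proof.
have H (p q : V) (U W : {vspace V}) :
    [set p + u | u in [set` U]] = [set q + w | w in [set` W]] ->
    (U <= W)%VS.
  move=> E; apply/subvP => u uU.
  have [w wW qwE] : [set q + w | w in [set` W]] p.
    by rewrite -E; exists 0; rewrite ?addr0 //= mem0v.
  have [w' w'W qw'E] : [set q + w | w in [set` W]] (p + u).
    by rewrite -E; exists u.
  have -> : u = w' - w.
    by apply: (addrI p); rewrite -qw'E -qwE -addrA [w + _]addrC subrK.
  exact: memvB.
move=> [p [U [EU <-]]] [q [W [EW <-]]]; congr (\dim _).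
by apply/eqP; rewrite eqEsubv (H p q) ?(H q p) // -EU -EW.
Qed.

End AffineGeometry.

Section LinearOrdering.
Variables (R : realType) (n : nat).

Definition opair : Type := {p : 'I_n * 'I_n | p.1 != p.2}.

Lemma card_opair : #|{: opair}| = (n * (n - 1))%N.
Proof.
rewrite card_sig -sum1_card.
rewrite -(pair_big_dep xpredT (fun i j : 'I_n => i != j) (fun _ _ => 1%N)) /=.
rewrite (eq_bigr (fun=> (n - 1)%N)) => [|i _].
  by rewrite sum_nat_const card_ord.
rewrite sum1_card subn1 -[in RHS](card_ord n) -(cardC1 i).
by apply: eq_card => j; rewrite !inE eq_sym.
Qed.

(* The total function (i, j) |-> x_ij; its value 0 on the diagonal is junk and
   is never used below. *)
Definition entry (x : 'rV[R]_#|{: opair}|) (i j : 'I_n) : R :=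
  if insub (i, j) is Some p then x 0 (enum_rank (p : opair)) else 0.

Lemma entryE (x : 'rV[R]_#|{: opair}|) (i j : 'I_n) (hij : i != j) :
  entry x i j = x 0 (enum_rank (exist _ (i, j) hij : opair)).
Proof.
by rewrite /entry (@insubT _ (fun p : 'I_n * 'I_n => p.1 != p.2) _ (i, j) hij).
Qed.

Definition binary (m : nat) (v : 'rV[R]_m) : Prop :=
  forall k, v 0 k = 0 \/ v 0 k = 1.

Definition linear_ordering_constraints (x : 'rV[R]_#|{: opair}|) : Prop :=
  (forall i j : 'I_n, (i < j)%N -> entry x i j + entry x j i = 1) /\
  (forall i j k : 'I_n, (i < j)%N -> (i < k)%N -> j != k ->
     entry x i j + entry x j k + entry x k i <= 2).

Local Notation N := #|{: opair}|.

Definition diameter_points : set 'rV[R]_(N + (N + N)) :=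
  [set v | exists x y z : 'rV[R]_N,
     [/\ v = row_mx x (row_mx y z), binary v,
         linear_ordering_constraints x, linear_ordering_constraints y
       & forall i j : 'I_n, i != j ->
           entry x i j + entry y i j - entry z i j <= 1]].

Definition diameter_polytope : set 'rV[R]_(N + (N + N)) :=
  convex_hull diameter_points.

End LinearOrdering.

Arguments diameter_points : clear implicits.
Arguments diameter_polytope : clear implicits.

(* Main.v *)
From HB Require Import structures.
Require Import Defs.
From mathcomp Require Import all_boot all_order all_algebra.
From mathcomp Require Import boolp classical_sets reals convex.
From mathcomp Require Import interval_inference zify ring lra.

(** Every vertex satisfies the [n(n-1)] independent equations
    [x_ij + x_ji = 1] and [y_ij + y_ji = 1], which leaves
    [3n(n-1) - n(n-1) = 2n(n-1)] dimensions; the point is that no further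
    equation holds.

    For the upper bound, the solutions of the homogeneous equations are
    parametrised injectively by [R^N * R^N], where [N = n(n-1)] (the map
    [direction]).  An antisymmetric vector is determined by its entries above
    the diagonal, or by those below it, so the two antisymmetric vectors
    [x] and [y] are together the same thing as one arbitrary vector [c]: its
    upper half gives [x] and its lower half gives [y].  In this way the
    dimension of the solution space is read off without counting pairs
    [i < j].

    For the lower bound, the translations preserving an affine set form a
    linear subspace that contains all differences of its points, so it
    suffices to get each basis direction as a difference of two vertices.
    - The direction [e_ij - e_ji] in [x] (or in [y]): the linear order that
      starts with [i, j] and the one that starts with [j, i] differ only in
      the pair [i, j].  With [z] all ones every pair of orders is feasible
      ([direction_x], [direction_y]).
    - The direction [e_ij] in [z]: if [j] precedes [i] in both orders, then
      [z_ij] may be 0 or 1 ([direction_z]). *)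

Set Implicit Arguments.
Unset Strict Implicit.
Unset Printing Implicit Defensive.

Import Order.TTheory GRing.Theory Num.Theory.

Local Open Scope classical_set_scope.
Local Open Scope ring_scope.

(** * Affine sets *)

Section AffineSets.
Variables (R : realType) (V : vectType R).
Implicit Types (A B : set V) (U : {vspace V}).

Lemma affine_set_convex A : affine_set A -> convex_set A.
Proof.
move=> affA x y t /set_mem Ax /set_mem Ay; apply/mem_set.
exact: (affA t%:inum).
Qed.

Lemma affine_coset (p : V) U : affine_set [set p + u | u in [set` U]].
Proof.
move=> t _ _ [u /= uU <-] [w /= wU <-].
exists (t *: u + (1 - t) *: w); first by apply: memvD; apply: memvZ.
by rewrite !scalerDr addrACA -scalerDl subrKC scale1r.
Qed.

Definition stabilizes B (u : V) : Prop := forall q, B q -> B (q + u).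

Section Stabilizer.
Variables (B : set V) (affB : affine_set B).

(** The fourth vertex of a parallelogram: [q + v - w] lies on the line through
    [w] and the midpoint of [q] and [v]. *)
Lemma stabilizes_sub v w : B v -> B w -> stabilizes B (v - w).
Proof.
move=> Bv Bw q Bq.
have /(affB 2) /(_ Bw) : B (2^-1 *: q + (1 - 2^-1) *: v) by exact: affB.
congr (B _); rewrite scalerDr !scalerA mulfV ?pnatr_eq0 // scale1r.
have -> : 2 * (1 - 2^-1) = 1 :> R by field.
have -> : 1 - 2 = - 1 :> R by ring.
by rewrite scale1r scaleN1r addrA.
Qed.

Lemma stabilizes0 : stabilizes B 0.
Proof. by move=> q; rewrite addr0. Qed.

Lemma stabilizesD u w :
  stabilizes B u -> stabilizes B w -> stabilizes B (u + w).
Proof. by move=> Bu Bw q Bq; rewrite addrA; apply/Bw/Bu. Qed.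

Lemma stabilizesZ t u : stabilizes B u -> stabilizes B (t *: u).
Proof.
move=> Bu q Bq; have := affB t (Bu q Bq) Bq; congr (B _).
by rewrite scalerDr addrAC -scalerDl subrKC scale1r.
Qed.

End Stabilizer.

(** The convex hull does not enlarge the affine hull, so both inclusions can
    be tested on the generating points. *)
Lemma affine_hull_convex_hull A (p : V) U :
  A `<=` [set p + u | u in [set` U]] -> A p ->
  (forall B u, affine_set B -> A `<=` B -> u \in U -> stabilizes B u) ->
  affine_hull (convex_hull A) = [set p + u | u in [set` U]].
Proof.
move=> AU Ap stabU; apply/seteqP; split.
  apply: smallest_sub; first exact: affine_coset.
  by apply: smallest_sub AU; apply/affine_set_convex/affine_coset.
move=> _ [u uU <-] B [affB hullB].
have AB : A `<=` B by move=> x Ax; apply: hullB; exact: sub_gen_smallest.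
by apply: (stabU B u) => //; exact: AB.
Qed.

End AffineSets.

(** * Vertices from pairs of linear orders *)

Section Diameter.
Variables (R : realType) (n : nat).
Local Notation pair := (opair n).
Local Notation N := #|{: opair n}|.
Implicit Types (p q : pair) (r s : 'I_n -> nat) (b : pred pair).

Fact swap_subproof p : (val p).2 != (val p).1.
Proof. by rewrite eq_sym; exact: valP p. Qed.

Definition swap p : pair :=
  exist (fun e : 'I_n * 'I_n => e.1 != e.2) ((val p).2, (val p).1)
    (swap_subproof p).

Definition up p : bool := ((val p).1 < (val p).2)%N.

Lemma swapK : involutive swap.
Proof. by move=> p; apply/val_inj; case: p => [[i j] ?]. Qed.

Lemma up_swap p : up (swap p) = ~~ up p.
Proof.
case: p => [[i j] /= ij]; rewrite /up /= ltnNge leq_eqVlt.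
by rewrite val_eqE (negPf ij).
Qed.

Lemma swap_neq p : (swap p == p) = false.
Proof. by apply/negP => /eqP E; have := up_swap p; rewrite E; case: up. Qed.

Lemma eq_swap p q : (q == swap p) = (swap q == p).
Proof. by apply/eqP/eqP => [->|<-]; rewrite swapK. Qed.

Definition row_of (f : pair -> R) : 'rV[R]_N := \row_k f (enum_val k).

Lemma row_ofE f p : row_of f 0 (enum_rank p) = f p.
Proof. by rewrite mxE enum_rankK. Qed.

Lemma row_pairP (x y : 'rV[R]_N) :
  (forall p, x 0 (enum_rank p) = y 0 (enum_rank p)) -> x = y.
Proof. by move=> E; apply/rowP => k; rewrite -(enum_valK k). Qed.

Lemma entry_pair (x : 'rV[R]_N) p :
  entry x (val p).1 (val p).2 = x 0 (enum_rank p).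
Proof.
by case: p => [[i j] /= ij]; rewrite entryE; congr (x 0 (enum_rank _)).
Qed.

Definition before r p : bool := (r (val p).1 < r (val p).2)%N.

Definition order_row r : 'rV[R]_N := row_of (fun p => (before r p)%:R).

Lemma entry_order r (i j : 'I_n) :
  i != j -> entry (order_row r) i j = (r i < r j)%N%:R.
Proof. by move=> ij; rewrite entryE row_ofE. Qed.

Lemma order_constraints r :
  injective r -> linear_ordering_constraints (order_row r).
Proof.
move=> injr; split=> [i j ij|i j k ij ik jk].
  have nij : i != j by rewrite -val_eqE neq_ltn ij.
  rewrite !entry_order ?(eq_sym j) //.
  by case: ltngtP => [||/injr/eqP]; rewrite ?addr0 ?add0r // (negPf nij).
have nij : i != j by rewrite -val_eqE neq_ltn ij.
have nki : k != i by rewrite -val_eqE neq_ltn ik orbT.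
rewrite !entry_order // -!natrD ler_nat.
(* A sum of 3 would mean [r i < r j < r k < r i]. *)
by move: (r i) (r j) (r k) => a b c; lia.
Qed.

Definition vertex r s b : 'rV[R]_(N + (N + N)) :=
  row_mx (order_row r) (row_mx (order_row s) (row_of (fun p => (b p)%:R))).

Lemma vertex_diameter r s b : injective r -> injective s ->
  (forall p, before r p -> before s p -> b p) ->
  diameter_points R n (vertex r s b).
Proof.
move=> injr injs rsb.
exists (order_row r), (order_row s), (row_of (fun p => (b p)%:R)); split => //.
- have bin01 (c : bool) : (c%:R = 0 :> R) \/ (c%:R = 1 :> R).
    by case: c; [right|left].
  move=> k; rewrite mxE; case: split => {}k; first by rewrite mxE.
  by rewrite mxE; case: split => {}k; rewrite mxE.
- exact: order_constraints.
- exact: order_constraints.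
move=> i j ij; have := rsb (exist _ (i, j) ij).
rewrite !entry_order // [entry _ i j]entryE row_ofE /before /=.
set c := b _; case: (r i < r j)%N; case: (s i < s j)%N;
  case: c => /= H; lra.
Qed.

(** The constant 1 in [x_ij + x_ji = 1] cancels. *)
Lemma antisym_difference (x y : 'rV[R]_N) p :
  linear_ordering_constraints x -> linear_ordering_constraints y ->
  (x - y) 0 (enum_rank (swap p)) = - (x - y) 0 (enum_rank p).
Proof.
suff sum1 (u : 'rV[R]_N) : linear_ordering_constraints u ->
    u 0 (enum_rank (swap p)) = 1 - u 0 (enum_rank p).
  by move=> /sum1 Ex /sum1 Ey; rewrite !mxE Ex Ey; ring.
move=> [uE _]; rewrite -!entry_pair /=.
move: p => [[i j] /= ij].
move: (ij); rewrite -val_eqE neq_ltn => /orP[] /uE <-; ring.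
Qed.

(** The shift by 2 keeps the ranks 0 and 1 free for [i] and [j]. *)
Definition start_with (i j k : 'I_n) : nat :=
  if k == i then 0%N else if k == j then 1%N else k.+2.

Lemma start_with_inj i j : i != j -> injective (start_with i j).
Proof.
move=> ij k l; rewrite /start_with.
by repeat case: eqP => [?|_]; rewrite //=; try congruence; move=> [/val_inj].
Qed.

Definition first_pair p := start_with (val p).1 (val p).2.

Lemma first_pair_inj p : injective (first_pair p).
Proof. exact/start_with_inj/(valP p). Qed.

Lemma before_first_pair_swap p : before (first_pair (swap p)) p = false.
Proof.
case: p => [[i j] /= ij].
by rewrite /before /first_pair /start_with /= !eqxx (negPf ij).
Qed.

Definition pair_row p : 'rV[R]_N := row_of (fun q => (q == p)%:R).

(** Exchanging two adjacent elements of an order changes no other pair. *)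
Lemma order_exchange p :
  order_row (first_pair p) - order_row (first_pair (swap p))
    = pair_row p - pair_row (swap p).
Proof.
apply: row_pairP => q; rewrite !mxE !enum_rankK eq_swap.
rewrite -!val_eqE; case: p q => [[i j] /= ij] [[k l] /= kl].
rewrite /before /first_pair /start_with /= !xpair_eqE.
case: (k =P i) => ki; case: (l =P i) => li; case: (k =P j) => kj;
  case: (l =P j) => lj; move: ij kl => /eqP ij /eqP kl; try congruence.
all: by rewrite /= ?subrr ?subr0 ?sub0r.
Qed.

(** * The direction space *)

(** An antisymmetric vector is determined by either half of its entries.  For
    the part [half] of the pairs (above the diagonal for [true], below for
    [false]), this is the antisymmetric vector that agrees with [c] there. *)
Definition alternate (half : bool) (c : 'rV[R]_N) : 'rV[R]_N :=
  row_of (fun p => if up p == half then c 0 (enum_rank p)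
                   else - c 0 (enum_rank (swap p))).

Definition direction (w : 'rV[R]_(N + N)) : 'rV[R]_(N + (N + N)) :=
  row_mx (alternate true (lsubmx w))
    (row_mx (alternate false (lsubmx w)) (rsubmx w)).

Lemma alternate_linear (half : bool) : linear (alternate half).
Proof.
move=> t c d; apply: row_pairP => p; rewrite /alternate !mxE !enum_rankK.
by case: eqP => _ //; ring.
Qed.

Lemma direction_linear : linear direction.
Proof.
move=> t v w; rewrite /direction !linearP /= !alternate_linear.
by rewrite !scale_row_mx !add_row_mx.
Qed.

HB.instance Definition _ :=
  GRing.isLinear.Build R 'rV[R]_(N + N) 'rV[R]_(N + (N + N)) _ direction
    direction_linear.

Lemma direction_inj : injective direction.
Proof.
move=> v w /eq_row_mx[Et /eq_row_mx[Ef Er]].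
rewrite -[v]hsubmxK -[w]hsubmxK Er; congr row_mx; apply: row_pairP => p.
have := congr1 (fun x : 'rV[R]_N => x 0 (enum_rank p)) Et.
have := congr1 (fun x : 'rV[R]_N => x 0 (enum_rank p)) Ef.
by rewrite !row_ofE; case: (up p).
Qed.

Lemma alternate_antisym (half : bool) (c d : 'rV[R]_N) :
  (forall p, d 0 (enum_rank (swap p)) = - d 0 (enum_rank p)) ->
  (forall p, up p == half -> c 0 (enum_rank p) = d 0 (enum_rank p)) ->
  alternate half c = d.
Proof.
move=> antid cd; apply: row_pairP => p; rewrite row_ofE.
case: ifP => [/cd //|uph].
rewrite cd ?antid ?opprK // up_swap.
by case: (up p) uph; case: half {cd}.
Qed.

Lemma alternate_pair_row (half : bool) p :
  alternate half (pair_row p) =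
    if up p == half then pair_row p - pair_row (swap p) else 0.
Proof.
apply: row_pairP => q.
case: (eqVneq (up p) half) => uph; rewrite !mxE !enum_rankK ?eq_swap.
  case: (eqVneq q p) => [->|qp]; first by rewrite uph eqxx swap_neq subr0.
  rewrite sub0r; case: (eqVneq (swap q) p) => [E|_].
    by move: uph; rewrite -E up_swap; case: (up q) => <-.
  by rewrite oppr0 if_same.
case: (eqVneq q p) => [->|qp]; first by rewrite (negPf uph) swap_neq oppr0.
case: (eqVneq (swap q) p) => [E|_]; last by rewrite oppr0 if_same.
by move: uph; rewrite -E up_swap; case: (up q); case: half.
Qed.

Definition base : 'rV[R]_(N + (N + N)) :=
  vertex (@nat_of_ord n) (@nat_of_ord n) predT.

Lemma base_diameter : diameter_points R n base.
Proof. by apply: vertex_diameter => // ? ? /val_inj. Qed.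

(** The difference of a vertex and [base] is antisymmetric in [x] and in [y],
    so the upper half of the first and the lower half of the second can be
    stored side by side in one vector [c], from which both are recovered. *)
Lemma diameter_directions :
  diameter_points R n `<=` [set base + u | u in [set` limg (linfun direction)]].
Proof.
move=> _ [x [y [z [-> _ cx cy _]]]].
have c0 : linear_ordering_constraints (order_row (@nat_of_ord n)).
  exact/order_constraints/val_inj.
pose c : 'rV[R]_N := row_of (fun p =>
  (if up p then x else y) 0 (enum_rank p)
    - order_row (@nat_of_ord n) 0 (enum_rank p)).
pose w := row_mx c (z - row_of (fun=> 1)).
exists (linfun direction w); first exact/memv_img/memvf.
rewrite lfunE /= /direction row_mxKl row_mxKr.
rewrite (@alternate_antisym true c (x - order_row (@nat_of_ord n))).
- rewrite (@alternate_antisym false c (y - order_row (@nat_of_ord n))).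
  + by rewrite !add_row_mx !subrKC.
  + by move=> p; exact: antisym_difference.
  by move=> p /eqP up_p; rewrite row_ofE up_p !mxE.
- by move=> p; exact: antisym_difference.
by move=> p /eqP up_p; rewrite row_ofE up_p !mxE.
Qed.

(** * Each basis direction is a difference of vertices *)

Section Spanning.
Variables (B : set 'rV[R]_(N + (N + N))).
Hypotheses (affB : affine_set B) (ptsB : diameter_points R n `<=` B).

Lemma stabilizes_vertices r s b r' s' b' :
  injective r -> injective s -> injective r' -> injective s' ->
  (forall p, before r p -> before s p -> b p) ->
  (forall p, before r' p -> before s' p -> b' p) ->
  stabilizes B (vertex r s b - vertex r' s' b').
Proof.
by move=> *; apply: stabilizes_sub => //; apply: ptsB; exact: vertex_diameter.
Qed.

Lemma direction_x p :
  stabilizes B (row_mx (pair_row p - pair_row (swap p)) (row_mx 0 0)).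
Proof.
have := @stabilizes_vertices (first_pair p) (first_pair p) predT
  (first_pair (swap p)) (first_pair p) predT.
rewrite !opp_row_mx !add_row_mx !subrr order_exchange.
by apply=> //; exact: first_pair_inj.
Qed.

Lemma direction_y p :
  stabilizes B (row_mx 0 (row_mx (pair_row p - pair_row (swap p)) 0)).
Proof.
have := @stabilizes_vertices (first_pair p) (first_pair p) predT
  (first_pair p) (first_pair (swap p)) predT.
rewrite !opp_row_mx !add_row_mx !subrr order_exchange.
by apply=> //; exact: first_pair_inj.
Qed.

(** With [p] reversed in both orders, the entry of [z] at [p] is free. *)
Lemma direction_z p : stabilizes B (row_mx 0 (row_mx 0 (pair_row p))).
Proof.
set r := first_pair (swap p).
have := @stabilizes_vertices r r predT r r (predC1 p).
rewrite !opp_row_mx !add_row_mx !subrr.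
have -> : row_of (fun q => (predT q)%:R) - row_of (fun q => (predC1 p q)%:R)
    = pair_row p.
  apply: row_pairP => q; rewrite !mxE !enum_rankK /=.
  by case: eqP => _; rewrite ?subrr ?subr0.
apply=> //; try exact: first_pair_inj.
by move=> q /=; case: eqP => // ->; rewrite /r before_first_pair_swap.
Qed.

(** The basis vector of the pair [p] in the first factor of the parameter space
    moves only [x] if [p] is above the diagonal, and only [y] if it is below. *)
Lemma stabilizes_direction w : stabilizes B (direction w).
Proof.
rewrite [w]row_sum_delta linear_sum /=.
apply: big_ind => [||k _]; [exact: stabilizes0|exact: stabilizesD|].
rewrite linearZ /=; apply: stabilizesZ => //.
have deltaE i : delta_mx 0 i = pair_row (enum_val i).
  by apply: row_pairP => p; rewrite !mxE eqxx enum_rankK;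
    rewrite -(can_eq enum_valK) enum_rankK.
case: (split_ordP k) => i ->.
  rewrite delta_mx_lshift deltaE /direction row_mxKl row_mxKr.
  rewrite !alternate_pair_row.
  by case: up; [exact: direction_x|exact: direction_y].
rewrite delta_mx_rshift deltaE /direction row_mxKl row_mxKr.
have alternate0 half : alternate half 0 = 0.
  by apply: row_pairP => p; rewrite row_ofE !mxE oppr0 if_same.
by rewrite !alternate0; exact: direction_z.
Qed.

End Spanning.

End Diameter.

Theorem proposition3p3 (R : realType) (n : nat) (hn : (2 <= n)%N) :
  affine_dim (diameter_polytope R n) (2 * n * (n - 1))%N.
Proof.
exists (base R n), (limg (linfun (@direction R n))); split.
  apply: affine_hull_convex_hull => [||B u affB ptsB /memv_imgP[w _ ->]].
  - exact: diameter_directions.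
  - exact: base_diameter.
  by rewrite lfunE /=; exact: stabilizes_direction.
rewrite limg_dim_eq.
  by rewrite dimvf dim_matrix card_opair; lia.
have /lker0P/eqP -> : injective (linfun (@direction R n)).
  by move=> v w; rewrite !lfunE; exact: direction_inj.
by rewrite capv0.
Qed.
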